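(* Let $(G,R)$ be any rooted graph, and let $v,w\in VG$ be any two vertices such that there is an injection $\theta:o^{-1}(w)\to o^{-1}(v)$ with $t(\theta(e))=t(e)$ for all $e\in o^{-1}(w)$. Let $G(w\hookrightarrow v)$ be the graph with vertex set $VG$ and edge set $\big(EG\setminus\theta(o^{-1}(w))\big)\cup\{f_{v,w}\}$, where $f_{v,w}$ is a new edge with origin $v$ and terminus $w$ and all other edges keep their origin and terminus. Then $$\mathcal{HT}\big(\mathcal{T}(G,R)\big)\cong \mathcal{HT}\Big(\mathcal{T}\big(G(w\hookrightarrow v),R\big)\Big).$$
   Context: Graphs are directed with multiple edges and loops allowed: $G=(VG,EG,o,t)$ with origin and terminus maps $o,t:EG\to VG$. All graphs are locally finite: $|o^{-1}(v)|<\infty$ for every $v\in VG$. A path is either an empty path $\varepsilon_v$ ($v\in VG$) or a word $e_1\dots e_n$ ($n\ge 1$) of edges with $t(e_i)=o(e_{i+1})$. $\mathcal{W}(G)$ is the set of all paths; $O(e_1\dots e_n)=o(e_1)$, $T(e_1\dots e_n)=t(e_n)$, $O(\varepsilon_v)=T(\varepsilon_v)=v$; $\mathcal{W}(G,v)$ is the set of paths $p$ with $O(p)=v$. Paths $p,q$ with $T(p)=O(q)$ are concatenated to $pq$, empty paths being neutral. A rooted graph $(G,R)$ is a graph $G$ with a vertex $R$ (the root) from which every vertex can be reached by a directed path. The unfolding tree $\mathcal{T}(G,R)$ has vertex set $\mathcal{W}(G,R)$ and edges $(p,pe)$ from $p$ to $pe$. The prefix order is $p\preceq q\iff q=pr$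 for some path $r$. A set of paths is independent if none of its elements is a prefix of another one. A cofinite subspace of $\mathcal{T}(G,R)$ is a subset $\mathcal{S}\subseteq\mathcal{W}(G,R)$ with finite complement such that $p\in\mathcal{S}$, $p\preceq q$ imply $q\in\mathcal{S}$. Its basis is the unique finite independent subset $B\subseteq\mathcal{S}$ such that every $p\in\mathcal{S}$ has a prefix in $B$. An almost automorphism representative is an isomorphism $\phi:\mathcal{S}\to\mathcal{S}'$ between cofinite subspaces (a bijection preserving the prefix/forest structure in both directions). It is a Higman--Thompson representative if, for the basis $B$ of its domain, $\phi(bp)=\phi(b)p$ for all $b\in B$ and $p\in\mathcal{W}(G,T(b))$ (in particular $\phi(b)p$ is a path, so $T(\phi(b))=T(b)$). Two representatives are equivalent if they agree on some cofinite subspace. Equivalence classes of representatives form a group under composition of compatible (suitably restricted) representatives; $\mathcal{HT}(\mathcal{T}(G,R))$ is the subgroup of classes containing a Higman--Thompson representative.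
   Formalization: The two vertices v and w are assumed distinct; for v = w the claim fails, e.g. for one vertex with two loops and θ the identity, where G gives Thompson's group V while G(v↪v) is a single loop, whose group is ℤ. *)

(* Defs.v *)
From HB Require Import structures.
From mathcomp Require Import all_boot.
From mathcomp Require Import boolp classical_sets functions cardinality.

Set Implicit Arguments.
Unset Strict Implicit.
Unset Printing Implicit Defensive.

Local Open Scope classical_set_scope.
Local Open Scope quotient_scope.

Record digraph := Digraph {
  vertex : Type;
  edge : Type;
  origin : edge -> vertex;
  terminus : edge -> vertex }.

Definition locally_finite (G : digraph) : Prop :=
  forall v : vertex G, finite_set [set e : edge G | origin e = v].

Fixpoint is_walk (G : digraph) (v : vertex G) (s : seq (edge G)) : Prop :=
  if s is e :: s' then origin e = v /\ is_walk (terminus e) s' else True.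

(* [walk v] is the set of paths with origin [v]; its element with the empty
   word is the empty path at [v]. *)
Record walk (G : digraph) (v : vertex G) := Walk {
  word :> seq (edge G);
  wordP : is_walk v word }.

Definition target (G : digraph) (v : vertex G) (p : walk v) : vertex G :=
  last v [seq terminus e | e <- p].

Definition rooted (G : digraph) (R : vertex G) : Prop :=
  forall v : vertex G, exists p : walk R, target p = v.

Lemma is_walk_cat (G : digraph) (s1 s2 : seq (edge G)) (v : vertex G) :
  is_walk v (s1 ++ s2) <->
  is_walk v s1 /\ is_walk (last v [seq terminus e | e <- s1]) s2.
Proof.
elim: s1 v => [|e s1 IH] v /=; first by split=> [|[]].
by rewrite IH; split=> [[? []]|[[]]].
Qed.

Definition wcat (G : digraph) (v : vertex G) (p : walk v)
    (q : walk (target p)) : walk v :=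
  Walk (proj2 (is_walk_cat p q v) (conj (wordP p) (wordP q))).

Lemma walk_inj (G : digraph) (v : vertex G) (p q : walk v) :
  word p = word q -> p = q.
Proof.
case: p q => [s hs] [s' hs'] /= E; case: s' / E hs' => hs'.
by rewrite (Prop_irrelevance hs hs').
Qed.

Section UnfoldingTree.
Variables (G : digraph) (R : vertex G).

(* The vertex set of the unfolding tree T(G,R) is [walk R]; the tree structure
   is carried by the prefix order. *)
Local Notation W := (walk R).

Definition wprefix (p q : W) : Prop := exists r : walk (target p), q = wcat r.

Definition independent (B : set W) : Prop :=
  forall p q, B p -> B q -> wprefix p q -> p = q.

Definition cofinite_subspace (S : set W) : Prop :=
  finite_set (~` S) /\ forall p q, S p -> wprefix p q -> S q.

Definition basis (S B : set W) : Prop :=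
  [/\ finite_set B, B `<=` S, independent B &
      forall p, S p -> exists2 b, B b & wprefix b p].

(* The map [fn] is only meaningful on [dom]: its values elsewhere are junk,
   which is ignored by [equiv_rep]. *)
Record almost_aut := AlmostAut {
  dom : set W;
  cod : set W;
  fn :> W -> W;
  dom_cofinite : cofinite_subspace dom;
  cod_cofinite : cofinite_subspace cod;
  fn_bij : set_bij dom cod fn;
  fn_prefix : forall p q, dom p -> dom q ->
    (wprefix p q <-> wprefix (fn p) (fn q)) }.

(* The equality of words says that [phi (b p) = phi b p], where [phi b p] is a
   path because the targets of [b] and [phi b] agree. *)
Definition higman_thompson (phi : almost_aut) : Prop :=
  exists2 B, basis (dom phi) B &
    forall b, B b -> target (phi b) = target b /\
      forall p : walk (target b), word (phi (wcat p)) = word (phi b) ++ word p.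

Definition equiv_rep (phi psi : almost_aut) : Prop :=
  exists U, [/\ cofinite_subspace U, U `<=` dom phi, U `<=` dom psi &
                forall p, U p -> phi p = psi p].

Lemma wprefixP (p q : W) :
  wprefix p q <-> exists s, word q = word p ++ s.
Proof.
split=> [[r ->]|[s E]]; first by exists (word r).
have hs : is_walk (target p) s.
  by have := wordP q; rewrite E => /is_walk_cat [].
by exists (Walk hs); apply: walk_inj.
Qed.

Lemma wprefix_refl p : wprefix p p.
Proof. by apply/wprefixP; exists [::]; rewrite cats0. Qed.

Lemma wprefix_trans q p r : wprefix p q -> wprefix q r -> wprefix p r.
Proof.
move=> /wprefixP [s E] /wprefixP [s' E']; apply/wprefixP.
by exists (s ++ s'); rewrite E' E catA.
Qed.

Lemma wprefix_anti p q : wprefix p q -> wprefix q p -> p = q.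
Proof.
move=> /wprefixP [s E] /wprefixP [s' E']; apply: walk_inj.
have : size s = 0%N.
  have := congr1 size E'; rewrite E !size_cat -addnA -[LHS]addn0.
  by move/addnI/esym/eqP; rewrite addn_eq0 => /andP [/eqP].
by move/size0nil => s0; rewrite E s0 cats0.
Qed.

Lemma wprefix_total p q r :
  wprefix p r -> wprefix q r -> wprefix p q \/ wprefix q p.
Proof.
move=> /wprefixP [s E] /wprefixP [s' E'].
have Es : word p ++ s = word q ++ s' by rewrite -E.
case: (leqP (size (word p)) (size (word q))) => h; [left|right]; apply/wprefixP.
  exists (take (size q - size p) s).
  have := congr1 (take (size q)) Es; rewrite [RHS]take_size_cat // take_cat.
  by rewrite ltnNge h.
exists (take (size p - size q) s').
have := congr1 (take (size p)) Es; rewrite [LHS]take_size_cat // take_cat.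
by rewrite ltnNge (ltnW h).
Qed.

Lemma cofiniteT : cofinite_subspace setT.
Proof. by split=> //; rewrite setCT; apply: finite_set0. Qed.

Lemma cofiniteI S T :
  cofinite_subspace S -> cofinite_subspace T -> cofinite_subspace (S `&` T).
Proof.
move=> [fS uS] [fT uT]; split; first by rewrite setCI finite_setU.
by move=> p q [Sp Tp] pq; split; [apply: uS pq|apply: uT pq].
Qed.

Lemma fn_inj (phi : almost_aut) p q :
  dom phi p -> dom phi q -> phi p = phi q -> p = q.
Proof. by case: (fn_bij phi) => _ I _ hp hq; apply: I; rewrite inE. Qed.

Lemma fn_cod (phi : almost_aut) p : dom phi p -> cod phi (phi p).
Proof. by case: (fn_bij phi) => F _ _; apply: F. Qed.

Lemma fn_surj (phi : almost_aut) q :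
  cod phi q -> exists2 p, dom phi p & phi p = q.
Proof. by case: (fn_bij phi) => _ _ F /F. Qed.

Lemma image_cofinite (phi : almost_aut) U : U `<=` dom phi ->
  cofinite_subspace U -> cofinite_subspace (phi @` U).
Proof.
move=> Ud [fU uU]; split.
  apply: (@sub_finite_set _ _ (~` cod phi `|` phi @` (~` U))).
    move=> q nq; have [/fn_surj[p dp E]|] := pselect (cod phi q); last by left.
    right; exists p => // Up; apply: nq; by exists p.
  rewrite finite_setU; split; first by case: (cod_cofinite phi).
  exact: finite_image.
move=> _ q [p Up <-] pq.
have cq : cod phi q.
  by have [_ up] := cod_cofinite phi; apply: up pq; apply: fn_cod (Ud _ Up).
have [p' dp' E] := fn_surj cq.
exists p' => //; apply: (uU p) => //; apply/(fn_prefix (Ud _ Up) dp').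
by rewrite E.
Qed.

Lemma fn_inv_subproof (phi : almost_aut) q :
  exists p, cod phi q -> dom phi p /\ phi p = q.
Proof.
have [/fn_surj [p ? ?]|] := pselect (cod phi q); last by exists q.
by exists p.
Qed.

Definition fn_inv (phi : almost_aut) (q : W) : W :=
  sval (cid (fn_inv_subproof phi q)).

Lemma fn_invP (phi : almost_aut) q :
  cod phi q -> dom phi (fn_inv phi q) /\ phi (fn_inv phi q) = q.
Proof. by rewrite /fn_inv; case: cid => g /= h /h. Qed.

Lemma fn_invK (phi : almost_aut) p : dom phi p -> fn_inv phi (phi p) = p.
Proof. by move=> dp; have [d /fn_inj->] := fn_invP (fn_cod dp). Qed.

Lemma inv_bij (phi : almost_aut) : set_bij (cod phi) (dom phi) (fn_inv phi).
Proof.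
split.
- by move=> q /fn_invP [].
- move=> p q; rewrite !inE => /fn_invP [_ {2}<-] /fn_invP [_ {2}<-] E.
  by rewrite E.
- by move=> p dp; exists (phi p); [apply: fn_cod|apply: fn_invK].
Qed.

Lemma inv_prefix (phi : almost_aut) p q : cod phi p -> cod phi q ->
  (wprefix p q <-> wprefix (fn_inv phi p) (fn_inv phi q)).
Proof.
move=> /fn_invP [dp Ep] /fn_invP [dq Eq].
by have := fn_prefix dp dq; rewrite Ep Eq => h; split=> /h.
Qed.

Definition inv_rep (phi : almost_aut) : almost_aut :=
  AlmostAut (cod_cofinite phi) (dom_cofinite phi) (inv_bij phi)
            (@inv_prefix phi).

Lemma preimage_cofinite (phi : almost_aut) U : cofinite_subspace U ->
  cofinite_subspace (dom phi `&` (phi @^-1` U)).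
Proof.
move=> cU.
have -> : dom phi `&` (phi @^-1` U) = inv_rep phi @` (U `&` cod phi).
  apply/seteqP; split=> [p [dp Up]|_ [q [Uq cq] <-]].
    by exists (phi p); [split=> //; apply: fn_cod|apply: fn_invK].
  by have /= [? E] := fn_invP cq; split=> //=; rewrite E.
apply: image_cofinite; first by move=> q [].
by apply: cofiniteI => //; apply: cod_cofinite.
Qed.

Lemma id_bij : set_bij (setT : set W) setT idfun.
Proof. by split=> // p _; exists p. Qed.

Lemma id_prefix (p q : W) : setT p -> setT q ->
  (wprefix p q <-> wprefix (idfun p) (idfun q)).
Proof. by []. Qed.

Definition id_rep : almost_aut :=
  AlmostAut cofiniteT cofiniteT id_bij id_prefix.

Section Composition.
Variables phi psi : almost_aut.

Let comp_dom := dom psi `&` (psi @^-1` dom phi).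
Let comp_cod := phi @` (cod psi `&` dom phi).

Lemma comp_dom_cofinite : cofinite_subspace comp_dom.
Proof. exact/preimage_cofinite/dom_cofinite. Qed.

Lemma comp_cod_cofinite : cofinite_subspace comp_cod.
Proof.
apply: image_cofinite; first by move=> q [].
by apply: cofiniteI; [apply: cod_cofinite|apply: dom_cofinite].
Qed.

Lemma comp_bij : set_bij comp_dom comp_cod (phi \o psi).
Proof.
split.
- by move=> p [dp dq]; exists (psi p) => //; split=> //; apply: fn_cod.
- move=> p q; rewrite !inE => -[dp dp'] [dq dq'] E.
  by apply: (fn_inj dp dq); apply: (fn_inj dp' dq').
- by move=> _ [q [/fn_surj [p dp <-] dq] <-]; exists p.
Qed.

Lemma comp_prefix p q : comp_dom p -> comp_dom q ->
  (wprefix p q <-> wprefix ((phi \o psi) p) ((phi \o psi) q)).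
Proof.
move=> [dp dp'] [dq dq'].
by split=> [/(fn_prefix dp dq)/(fn_prefix dp' dq')|
            /(fn_prefix dp' dq')/(fn_prefix dp dq)].
Qed.

Definition comp_rep : almost_aut :=
  AlmostAut comp_dom_cofinite comp_cod_cofinite comp_bij comp_prefix.

End Composition.

Lemma equiv_rep_refl phi : equiv_rep phi phi.
Proof. by exists (dom phi); split=> //; apply: dom_cofinite. Qed.

Lemma equiv_rep_sym phi psi : equiv_rep phi psi -> equiv_rep psi phi.
Proof. by move=> [U [cU U1 U2 E]]; exists U; split=> // p /E. Qed.

Lemma equiv_rep_trans psi phi chi :
  equiv_rep phi psi -> equiv_rep psi chi -> equiv_rep phi chi.
Proof.
move=> [U [cU U1 U2 E]] [V [cV V1 V2 F]]; exists (U `&` V); split.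
- exact: cofiniteI.
- by move=> p [/U1].
- by move=> p [_ /V2].
- by move=> p [/E -> /F].
Qed.

Definition equiv_repb : rel almost_aut := fun phi psi => `[< equiv_rep phi psi >].

Lemma equiv_repb_refl : reflexive equiv_repb.
Proof. by move=> phi; apply/asboolP/equiv_rep_refl. Qed.

Lemma equiv_repb_sym : symmetric equiv_repb.
Proof. by move=> phi psi; apply/asboolP/asboolP; apply: equiv_rep_sym. Qed.

Lemma equiv_repb_trans : transitive equiv_repb.
Proof.
move=> psi phi chi /asboolP e /asboolP f.
by apply/asboolP; apply: equiv_rep_trans f.
Qed.

HB.instance Definition _ := gen_eqMixin almost_aut.
HB.instance Definition _ := gen_choiceMixin almost_aut.

Canonical equiv_rep_equiv :=
  EquivRel equiv_repb equiv_repb_refl equiv_repb_sym equiv_repb_trans.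

Definition AAut : Type := {eq_quot equiv_repb}.
HB.instance Definition _ := EqQuotient.on AAut.
HB.instance Definition _ := Choice.on AAut.

Definition aclass (phi : almost_aut) : AAut := \pi_AAut phi.

Lemma aclassP phi psi : aclass phi = aclass psi <-> equiv_rep phi psi.
Proof.
split; first by move/eqquotP/asboolP.
by move=> h; apply/eqquotP/asboolP.
Qed.

Lemma aclass_repr x : aclass (repr x) = x.
Proof. exact: reprK. Qed.

Lemma equiv_repr phi : equiv_rep (repr (aclass phi)) phi.
Proof. by apply/aclassP; rewrite aclass_repr. Qed.

Definition aone : AAut := aclass id_rep.
Definition amul (x y : AAut) : AAut := aclass (comp_rep (repr x) (repr y)).
Definition ainv (x : AAut) : AAut := aclass (inv_rep (repr x)).

Lemma comp_equiv phi phi' psi psi' : equiv_rep phi phi' ->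
  equiv_rep psi psi' -> equiv_rep (comp_rep phi psi) (comp_rep phi' psi').
Proof.
move=> [U [cU U1 U2 E]] [V [cV V1 V2 F]].
exists (V `&` (dom psi `&` (psi @^-1` U))); split.
- by apply: cofiniteI => //; apply: preimage_cofinite.
- by move=> p [Vp [dp /= Up]]; split=> //; apply: U1.
- move=> p [Vp [dp /= Up]]; split; first exact: V2.
  by rewrite /= -F //; apply: U2.
- by move=> p [Vp [dp /= Up]]; rewrite -F // E.
Qed.

Lemma inv_equiv phi psi : equiv_rep phi psi ->
  equiv_rep (inv_rep phi) (inv_rep psi).
Proof.
move=> [U [cU U1 U2 E]]; exists (phi @` U); split.
- exact: image_cofinite.
- by move=> _ [p /U1 dp <-]; apply: fn_cod.
- by move=> _ [p Up <-]; rewrite E //; apply/fn_cod/U2.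
- move=> _ [p Up <-] /=; rewrite fn_invK; last exact: U1.
  by rewrite E // fn_invK //; apply: U2.
Qed.

Lemma amulE phi psi : amul (aclass phi) (aclass psi) = aclass (comp_rep phi psi).
Proof. by apply/aclassP; apply: comp_equiv; apply: equiv_repr. Qed.

Lemma ainvE phi : ainv (aclass phi) = aclass (inv_rep phi).
Proof. by apply/aclassP; apply: inv_equiv; apply: equiv_repr. Qed.

Lemma equiv_ext phi psi : dom phi `<=` dom psi ->
  (forall p, dom phi p -> phi p = psi p) -> equiv_rep phi psi.
Proof. by move=> h E; exists (dom phi); split=> //; apply: dom_cofinite. Qed.

Lemma amulA : associative amul.
Proof.
move=> x y z; rewrite -(aclass_repr x) -(aclass_repr y) -(aclass_repr z) !amulE.
by apply/aclassP/equiv_ext => // p [[? ?] ?]; split.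
Qed.

Lemma amul1 : left_id aone amul.
Proof.
move=> x; rewrite -(aclass_repr x) amulE.
by apply/aclassP/equiv_ext => // p [].
Qed.

Lemma amulr1 : right_id aone amul.
Proof.
move=> x; rewrite -(aclass_repr x) amulE.
by apply/aclassP/equiv_ext => // p [].
Qed.

Lemma amulV : left_inverse aone ainv amul.
Proof.
move=> x; rewrite -(aclass_repr x) ainvE amulE; apply/aclassP/equiv_ext => //.
by move=> p [dp _] /=; apply: fn_invK.
Qed.

Lemma amulrV : right_inverse aone ainv amul.
Proof.
move=> x; rewrite -(aclass_repr x) ainvE amulE; apply/aclassP/equiv_ext => //.
by move=> p [/fn_invP []].
Qed.

HB.instance Definition _ :=
  isGroup.Build AAut amulA amul1 amulr1 amulV amulrV.

Definition HT_class : {pred AAut} :=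
  fun x => `[< exists2 phi, aclass phi = x & higman_thompson phi >].

Lemma cover_basis S C : finite_set C -> C `<=` S ->
  (forall p, S p -> exists2 c, C c & wprefix c p) ->
  exists2 B, B `<=` C & basis S B.
Proof.
move=> fC CS cov.
exists [set c | C c /\ forall d, C d -> wprefix d c -> d = c].
  by move=> c [].
split.
- by apply: sub_finite_set fC => c [].
- by move=> c [/CS].
- by move=> p q [Cp _] [_ mq] /(mq _ Cp).
- move=> p /cov [c Cc cp].
  have [n] := ubnP (size c); elim: n c Cc cp => // n IH c Cc cp sc.
  have [m|] := pselect (forall d, C d -> wprefix d c -> d = c).
    by exists c.
  move=> /existsNP [d /not_implyP [Cd /not_implyP [dc ndc]]].
  apply: (IH d) => //; first exact: wprefix_trans cp.
  have /wprefixP [[|e s] E] := dc.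
    by case: ndc; apply: walk_inj; rewrite E cats0.
  rewrite ltnS in sc; apply: leq_trans sc.
  by rewrite E size_cat /= addnS ltnS leq_addr.
Qed.

Definition shifts (phi : almost_aut) (c : W) : Prop :=
  target (phi c) = target c /\
  forall s d, word d = word c ++ s -> word (phi d) = word (phi c) ++ s.

Lemma target_cat (c d : W) s : word d = word c ++ s ->
  target d = last (target c) [seq terminus e | e <- s].
Proof. by move=> E; rewrite /target E map_cat last_cat. Qed.

Lemma HT_shifts phi : higman_thompson phi ->
  forall c, dom phi c -> shifts phi c.
Proof.
move=> [B [_ _ _ cov] hB] c /cov [b /hB [tb hb] [r Er]].
have sh s d : word d = word b ++ s -> word (phi d) = word (phi b) ++ s.
  move=> E; have /wprefixP [q Eq] : exists s, word d = word b ++ s by exists s.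
  by subst d; rewrite hb; congr cat; move: E => /= /(congr1 (drop (size b)));
    rewrite !drop_size_cat.
have Ec : word c = word b ++ word r by rewrite Er.
split=> [|s d Ed].
  by rewrite (target_cat Ec) (target_cat (sh _ _ Ec)) tb.
by rewrite (sh _ _ Ec) -catA; apply: sh; rewrite Ed Ec catA.
Qed.

Lemma shifts_HT phi C : finite_set C -> C `<=` dom phi ->
  (forall p, dom phi p -> exists2 c, C c & wprefix c p) ->
  (forall c, dom phi c -> shifts phi c) -> higman_thompson phi.
Proof.
move=> fC Cd cov sh; have [B BC bB] := cover_basis fC Cd cov.
by exists B => // b /BC/Cd/sh [t h]; split=> // p; apply: h.
Qed.

Lemma HT_id : higman_thompson id_rep.
Proof.
apply: (@shifts_HT _ [set @Walk G R [::] I]) => //.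
move=> p _; exists (@Walk G R [::] I) => //.
by apply/wprefixP; exists (word p).
Qed.

Lemma HT_inv phi : higman_thompson phi -> higman_thompson (inv_rep phi).
Proof.
move=> h; have sh := HT_shifts h; have [B [fB Bd _ cov] _] := h.
apply: (@shifts_HT _ (phi @` B)).
- exact: finite_image.
- by move=> _ [b /Bd db <-]; apply: fn_cod.
- move=> q /= /fn_invP [dp <-]; have [b Bb bp] := cov _ dp.
  by exists (phi b); [exists b|apply/(fn_prefix (Bd _ Bb) dp)].
- move=> _ /= /fn_surj [p dp <-]; have [tp hp] := sh _ dp.
  split=> /=; first by rewrite fn_invK.
  move=> s d Ed; rewrite fn_invK //.
  have hs : is_walk (target p) s.
    by have := wordP d; rewrite Ed -tp => /is_walk_cat [].
  have [_ up] := dom_cofinite phi.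
  have dps : dom phi (wcat (Walk hs)) by apply: (up p) => //; exists (Walk hs).
  suff -> : d = phi (wcat (Walk hs)) by rewrite fn_invK.
  by apply: walk_inj; rewrite Ed (hp s (wcat (Walk hs))).
Qed.

Lemma HT_comp phi psi : higman_thompson phi -> higman_thompson psi ->
  higman_thompson (comp_rep phi psi).
Proof.
move=> h k; have shh := HT_shifts h; have shk := HT_shifts k.
have [B [fB Bd _ covB] _] := h; have [C [fC Cd _ covC] _] := k.
have [_ up] := dom_cofinite phi.
apply: (@shifts_HT _ (dom (comp_rep phi psi) `&` (C `|` fn_inv psi @` B))).
- apply: (@sub_finite_set _ _ (C `|` fn_inv psi @` B)); first by move=> ? [].
  by rewrite finite_setU; split=> //; apply: finite_image.
- by move=> p [].
- move=> p [dp dpp]; have [c Cc cp] := covC _ dp.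
  have [b Bb bp] := covB _ dpp.
  have cp' := proj1 (fn_prefix (Cd _ Cc) dp) cp.
  have [bc|cb] := wprefix_total bp cp'.
    exists c => //; split; last by left.
    by split; [apply: Cd|apply: (up b) => //; apply: Bd].
  have cb' : cod psi b.
    by have [_ upc] := cod_cofinite psi; apply: upc cb; apply/fn_cod/Cd.
  have [db Eb] := fn_invP cb'.
  exists (fn_inv psi b).
    by split; [split=> //=; rewrite Eb; apply: Bd|right; exists b].
  by apply/(fn_prefix db dp); rewrite Eb.
- move=> c [dc dcc]; have [t1 h1] := shk _ dc; have [t2 h2] := shh _ dcc.
  by split=> /= [|s d Ed]; [rewrite t2|apply/h2/h1].
Qed.

Lemma HT_group_closed : group_closed HT_class.
Proof.
split=> [|x y /asboolP [phi <- h] /asboolP [psi <- k]].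
  by apply/asboolP; exists id_rep => //; apply: HT_id.
apply/asboolP; exists (comp_rep phi (inv_rep psi)).
  by rewrite -amulE -ainvE.
by apply: HT_comp => //; apply: HT_inv.
Qed.

Definition HT : Type := {x : AAut | HT_class x}.
HB.instance Definition _ := SubChoice.on HT.
HB.instance Definition _ := SubChoice_isSubGroup.Build AAut HT_class HT
  HT_group_closed.

End UnfoldingTree.

Arguments rooted G R : clear implicits.
Arguments HT G R : clear implicits.

Definition out_edge (G : digraph) (v : vertex G) : Type :=
  {e : edge G | origin e = v}.

(* The graph G(w `-> v): [None] is the new edge from [v] to [w], and [Some e]
   ranges over the edges outside of the image of [theta]. *)
Definition hook (G : digraph) (v w : vertex G)
    (theta : out_edge w -> out_edge v) : digraph :=
  @Digraph (vertex G)
    (option {e : edge G | ~ exists e' : out_edge w, sval (theta e') = e})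
    (oapp (fun e => origin (sval e)) v)
    (oapp (fun e => terminus (sval e)) w).

Definition isomorphic_groups (A B : groupType) : Prop :=
  exists f : {multiplicative A -> B}, bijective f.

(* Main.v *)
From HB Require Import structures.
Require Import Defs.
From mathcomp Require Import all_boot.
From mathcomp Require Import boolp classical_sets functions cardinality.

(* Replacing every rerouted edge theta(e) by the two-letter word f e, with f the
   new edge, encodes paths of G as paths of G(w `-> v). The code is a prefix
   code, so the encoding preserves and reflects the prefix order, and it misses
   exactly the paths ending in f. A Higman-Thompson representative phi of
   T(G,R) is transported to enc(p) s |-> enc(phi p) s, for p in its domain.
   Conversely, a representative of T(G(w `-> v),R) preserves the last edge of
   every path strictly below its basis, so there it restricts to encoded
   paths and can be decoded. Both constructions respect equivalence and
   composition. *)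

Set Implicit Arguments.
Unset Strict Implicit.
Unset Printing Implicit Defensive.

Local Open Scope classical_set_scope.

(** * Cofinite subspaces and shift maps over an arbitrary graph *)

Section Walks.
Variable G : digraph.

Lemma walk_extend (u : vertex G) (p : walk u) (s : seq (edge G)) :
  is_walk (target p) s -> exists d : walk u, word d = word p ++ s.
Proof. by move=> h; exists (wcat (Walk h)). Qed.

Lemma walk_split (u : vertex G) (d p : walk u) (s : seq (edge G)) :
  word d = word p ++ s -> is_walk (target p) s.
Proof. by move=> E; have := wordP d; rewrite E => /is_walk_cat []. Qed.

Variable R : vertex G.

Lemma cofinite_up (S : set (walk R)) (p d : walk R) (s : seq (edge G)) :
  cofinite_subspace S -> S p -> word d = word p ++ s -> S d.
Proof.
by move=> [_ up] Sp E; apply: (up p) => //; apply/wprefixP; exists s.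
Qed.

(** Every minimal element of [S] is the empty path or a one-edge extension of a path outside [S].
    These candidates are finitely many, since the complement is finite and each vertex has finitely
    many outgoing edges. *)
Lemma finite_cover (S : set (walk R)) :
  locally_finite G -> cofinite_subspace S ->
  exists C, [/\ finite_set C, C `<=` S &
    forall p, S p -> exists2 c, C c & wprefix c p].
Proof.
move=> lf [fS uS].
pose ch := [set q : walk R | exists p : walk R, ~ S p /\
  exists e, word q = rcons (word p) e].
pose r := @Walk G R [::] I.
exists (S `&` (r |` ch)); split.
- apply: (@sub_finite_set _ _ (r |` ch)); first by move=> ? [].
  rewrite finite_setU; split; first exact: finite_set1.
  apply: (@sub_finite_set _ _ ((@word G R) @^-1` (\bigcup_(p in ~` S)
      [set rcons (word p) e | e in [set e | origin e = target p]]))).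
    move=> q [p [nSp [e E]]]; exists p => //; exists e => //=.
    by have := @walk_split _ q p [:: e]; rewrite cats1 => /(_ E) [].
  apply: finite_preimage; first by move=> ? ? _ _; apply: walk_inj.
  apply: bigcup_finite => // p _; apply: finite_image; exact: lf.
- by move=> ? [].
(* Deleting last edges from [p] until the next deletion would leave [S] ends at a path of the
   cover. *)
- move=> p Sp; have [n] := ubnP (size p); elim: n p Sp => // n IH p Sp sp.
  case/lastP E: (word p) => [|s e].
    exists r; last by apply/wprefixP; exists (word p).
    by split; [suff -> : r = p by []; apply: walk_inj; rewrite E|left].
  have hs : is_walk R s.
    by have := wordP p; rewrite E -cats1 => /is_walk_cat [].
  have sn : (size s < n)%N by move: sp; rewrite E size_rcons ltnS.
  have [Sq|nSq] := pselect (S (Walk hs)).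
    have [c Cc cq] := IH _ Sq sn; exists c => //; apply: wprefix_trans cq _.
    by apply/wprefixP; exists [:: e]; rewrite /= E cats1.
  exists p; last exact: wprefix_refl.
  by split=> //; right; exists (Walk hs); split=> //; exists e.
Qed.

(** The common builder for both transports. If [f q] is [f p] followed by [s], then [s] can also be
    appended to [p], because targets agree, and injectivity makes the result [q]; so the prefix
    order is reflected. The same argument shows that the image is closed under extension. *)
Lemma HT_of_shift_map (U C : set (walk R)) (f : walk R -> walk R) :
  cofinite_subspace U -> finite_set C -> C `<=` U ->
  (forall p, U p -> exists2 c, C c & wprefix c p) ->
  (forall p, U p -> target (f p) = target p) ->
  (forall p d s, U p -> word d = word p ++ s ->
     word (f d) = word (f p) ++ s) ->
  (forall p q, U p -> U q -> f p = f q -> p = q) ->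
  finite_set (~` (f @` U)) ->
  exists phi : almost_aut R, [/\ higman_thompson phi, dom phi = U & fn phi = f].
Proof.
move=> cU fC CU cov tf sf inj fin.
have cV : cofinite_subspace (f @` U).
  split=> // _ q [p Up <-] /wprefixP [s E].
  have hs : is_walk (target p) s by rewrite -tf //; exact: walk_split E.
  have [d Ed] := walk_extend hs.
  exists d; first exact: cofinite_up Up Ed.
  by apply: walk_inj; rewrite E; apply: sf.
have f_bij : set_bij U (f @` U) f.
  by split=> // p q; rewrite !inE; apply: inj.
have pre p q : U p -> U q -> (wprefix p q <-> wprefix (f p) (f q)).
  move=> Up Uq; split=> /wprefixP [s E]; apply/wprefixP; exists s.
    exact: sf.
  have hs : is_walk (target p) s by rewrite -tf //; exact: walk_split E.
  have [d Ed] := walk_extend hs.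
  have Ef : f d = f q by apply: walk_inj; rewrite E; apply: sf.
  by rewrite -Ed (inj d q) //; exact: cofinite_up Up Ed.
exists (AlmostAut cU cV f_bij pre); split=> //.
apply: (shifts_HT fC) => // c Uc.
by split; [apply: tf|move=> s d; apply: sf].
Qed.

End Walks.

(** * The encoding of paths of [G] as paths of [hook theta] *)

Section Hook.
Variables (G : digraph) (R v w : vertex G) (theta : out_edge w -> out_edge v).
Hypotheses (vw : v <> w) (theta_inj : injective theta).
Hypothesis theta_term :
  forall e : out_edge w, terminus (sval (theta e)) = terminus (sval e).

Local Notation H := (hook theta).
Local Notation rerouted e := (exists e' : out_edge w, sval (theta e') = e).

(** The image of [theta] consists of edges leaving [v], and [v <> w], so the edges out of [w]
    survive in the new graph and can follow the new edge there. *)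
Lemma out_edge_kept (e : out_edge w) : ~ rerouted (sval e).
Proof.
move=> [e' E]; apply: vw.
by rewrite -(svalP (theta e')) -(svalP e) E.
Qed.

Definition kept (e : edge G) (h : ~ rerouted e) : edge H := Some (exist _ e h).

Definition enc_edge (e : edge G) : seq (edge H) :=
  match pselect (rerouted e) with
  | left h => [:: None; kept (@out_edge_kept (sval (cid h)))]
  | right h => [:: kept h]
  end.

Definition enc (s : seq (edge G)) : seq (edge H) := flatten (map enc_edge s).

Lemma enc_cat s t : enc (s ++ t) = enc s ++ enc t.
Proof. by rewrite /enc map_cat flatten_cat. Qed.

Lemma kept_eq e h e' h' : e = e' -> @kept e h = @kept e' h'.
Proof. by move=> E; subst e'; rewrite (Prop_irrelevance h h'). Qed.

(** [enc_edge] uses a preimage chosen by [cid]; injectivity of [theta] forces it to be [e]. *)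
Lemma enc_theta (e : out_edge w) :
  enc_edge (sval (theta e)) = [:: None; kept (@out_edge_kept e)].
Proof.
rewrite /enc_edge; case: pselect => [h|[]]; last by exists e.
congr [:: _; _]; apply: kept_eq; case: cid => e' /= E.
congr sval; apply: theta_inj; move: E.
case: (theta e) (theta e') => [a ha] [b hb] /= E; subst b.
by rewrite (Prop_irrelevance ha hb).
Qed.

Lemma enc_kept e (h : ~ rerouted e) : enc_edge e = [:: kept h].
Proof.
by rewrite /enc_edge; case: pselect => // h'; rewrite (Prop_irrelevance h' h).
Qed.

(** The first letter tells whether the edge is rerouted, and the last letter of the code then
    determines the edge. *)
Lemma enc_edge_prefix_code e1 e2 x1 x2 :
  enc_edge e1 ++ x1 = enc_edge e2 ++ x2 -> e1 = e2 /\ x1 = x2.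
Proof.
have [[e1' <-]|h1] := pselect (rerouted e1);
have [[e2' <-]|h2] := pselect (rerouted e2).
- rewrite !enc_theta /= => -[E ->]; split=> //; congr (sval (theta _)).
  case: e1' e2' E => [a ha] [b hb] /= E; subst b.
  by rewrite (Prop_irrelevance ha hb).
- by rewrite enc_theta enc_kept.
- by rewrite enc_theta enc_kept.
- by rewrite !enc_kept /= => -[-> ->].
Qed.

Lemma enc_total s1 s2 x1 x2 : enc s1 ++ x1 = enc s2 ++ x2 ->
  exists t, s2 = s1 ++ t \/ s1 = s2 ++ t.
Proof.
elim: s1 s2 => [|e1 s1 IH] [|e2 s2]; [by exists [::]; left| | |].
- by exists (e2 :: s2); left.
- by exists (e1 :: s1); right.
- rewrite /enc /= -!catA => /enc_edge_prefix_code [-> /IH [t [->|->]]].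
    by exists t; left.
  by exists t; right.
Qed.

Lemma enc_edge_nil e x : enc_edge e ++ x <> [::].
Proof. by rewrite /enc_edge; case: pselect. Qed.

(** By [enc_total] the two words are comparable. If [s1] is the longer one, its surplus has an empty
    code and is therefore empty. *)
Lemma enc_prefix s1 s2 x : enc s2 = enc s1 ++ x ->
  exists2 t, s2 = s1 ++ t & x = enc t.
Proof.
move=> E; have := E; rewrite -[LHS]cats0 => /enc_total [t [E'|E']].
  move: E; rewrite E' enc_cat -catA => /(congr1 (drop (size (enc s2)))).
  rewrite drop_size_cat // drop_oversize // => /esym.
  case: t E' => [|e t] E'; last by rewrite /enc /= -catA => /enc_edge_nil.
  by exists [::]; rewrite ?cats0 // E' cats0.
exists t => //; move: E; rewrite E' enc_cat => /(congr1 (drop (size (enc s1)))).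
by rewrite !drop_size_cat.
Qed.

Lemma enc_inj : injective enc.
Proof.
move=> s1 s2 E; have [t Et] : exists2 t, s2 = s1 ++ t & [::] = enc t.
  by apply: enc_prefix; rewrite cats0.
case: t Et => [|e t] ->; first by rewrite cats0.
by rewrite /enc /= => /esym/enc_edge_nil.
Qed.

(** The detour replacing a rerouted edge passes through [w] and ends where that edge ended, by
    [theta_term]. *)
Lemma enc_walk (u : vertex G) (s : seq (edge G)) : is_walk u s ->
  @is_walk H u (enc s) /\
  last u [seq @terminus H e | e <- enc s] = last u [seq terminus e | e <- s].
Proof.
elim: s u => [//|e s IH] u /= [hu /IH [hs Es]]; rewrite /enc /= -/(enc s).
have [[e' E]|h] := pselect (rerouted e).
  subst e; rewrite enc_theta /=; rewrite theta_term in hs Es *.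
  split=> //; split; first by rewrite -hu (svalP (theta e')).
  by split=> //; apply: (svalP e').
by rewrite (enc_kept h).
Qed.

Definition encW (p : walk R) : @walk H R := Walk (enc_walk (wordP p)).1.

Lemma target_encW p : target (encW p) = target p.
Proof. exact: (enc_walk (wordP p)).2. Qed.

Lemma encW_inj : injective encW.
Proof. by move=> p q /(congr1 (@word _ _))/enc_inj/walk_inj. Qed.

Lemma encW_prefix p q : wprefix (encW p) (encW q) <-> wprefix p q.
Proof.
split=> /wprefixP [s E]; apply/wprefixP.
  by have [t Et _] := enc_prefix E; exists t.
by exists (enc s); rewrite /= E enc_cat.
Qed.

(** After a complete code, a kept edge completes another code and [None] leaves one pending. A
    pending [None] ends at [w], where only kept edges start since [v <> w]; such an edge [e]
    completes the code of [theta e]. *)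
Lemma encW_cases (q : @walk H R) : exists p : walk R,
  word q = enc p \/ target p = v /\ word q = rcons (enc p) None.
Proof.
case: q => q /=; elim/last_ind: q => [|q x IH] hq.
  by exists (@Walk G R [::] I); left.
have [hq' hx] : @is_walk H R q /\
    origin x = last (R : vertex H) [seq terminus e | e <- q].
  by move: hq; rewrite -cats1 => /is_walk_cat [? []].
have [p] := IH hq'.
have keep (e : edge G) : origin e = target p ->
    exists p' : walk R, word p' = rcons (word p) e.
  move=> he; have h : is_walk (target p) [:: e] by [].
  by have [p' Ep] := walk_extend h; exists p'; rewrite Ep cats1.
case=> [E|[tp E]]; subst q; move: hx.
  rewrite (enc_walk (wordP p)).2 -/(target p).
  case: x hq => [[e he]|] _ /= hx; last by exists p; right.
  have [p' E] := keep _ hx; exists p'; left.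
  by rewrite E -!cats1 enc_cat /enc /= cats0 (enc_kept he).
rewrite map_rcons last_rcons /=; case: x hq => [[e he]|] _ /= hx; last first.
  by case: (vw hx).
have te : origin (sval (theta (exist _ e hx))) = target p.
  by rewrite tp (svalP (theta _)).
have [p' E] := keep _ te; exists p'; left.
rewrite E -[in RHS]cats1 enc_cat -!cats1 -catA /enc /= cats0 enc_theta /=.
by congr (_ ++ [:: _; _]); apply: kept_eq.
Qed.

(** Every edge code ends in a kept edge. Together with [encW_cases], the image of [encW] consists
    exactly of the paths not ending in [None]. *)
Lemma enc_no_hook s t : enc s <> rcons t None.
Proof.
case/lastP: s => [|s e]; first by case: t.
rewrite -cats1 enc_cat /enc /= cats0.
rewrite /enc_edge; case: pselect => h.
  rewrite -(cat1s None) catA !cats1 -/(enc s) => /rcons_inj [].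
  by [].
by rewrite cats1 => /rcons_inj [].
Qed.

(** * Cofinite subspaces and representatives under the encoding *)

Lemma encW_preimage_cofinite (U : set (@walk H R)) :
  cofinite_subspace U -> cofinite_subspace (encW @^-1` U).
Proof.
move=> [fU uU]; split.
  rewrite preimage_setC; apply: finite_preimage => // p q _ _.
  exact: encW_inj.
by move=> p q Up pq; apply: (uU _ _ Up); apply/encW_prefix.
Qed.

(** By [encW_cases] a missed path is the code of some [p], possibly followed by [None], and [p] lies
    outside [S]; so each of the finitely many such [p] accounts for at most two missed paths. *)
Lemma encW_upset_cofinite (S : set (walk R)) : cofinite_subspace S ->
  cofinite_subspace [set q | exists2 p, S p & wprefix (encW p) q].
Proof.
move=> [fS _]; split; last first.
  by move=> q q' [p Sp pq] qq'; exists p => //; apply: wprefix_trans qq'.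
apply: (@sub_finite_set _ _ (@word H R @^-1`
  ((enc \o @word G R) @` (~` S) `|`
   ((rcons^~ None) \o enc \o @word G R) @` (~` S)))); last first.
  apply: finite_preimage; first by move=> ? ? _ _; apply: walk_inj.
  by rewrite finite_setU; split; apply: finite_image.
move=> q nq; have [p Ep] := encW_cases q.
have nSp : ~ S p.
  move=> Sp; apply: nq; exists p => //; apply/wprefixP.
  case: Ep => [E|[_ E]]; first by exists [::]; rewrite E cats0.
  by exists [:: None]; rewrite E cats1.
by case: Ep => [E|[_ E]]; [left|right]; exists p.
Qed.

(** Intertwining by [encW] is required only on some cofinite subspace, which makes the relation
    invariant under equivalence; it says nothing directly about paths ending in [None]. *)
Definition corr (phi : almost_aut R) (phi' : @almost_aut H R) : Prop :=
  exists U, [/\ cofinite_subspace U, U `<=` dom phi,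
    forall p, U p -> dom phi' (encW p) &
    forall p, U p -> phi' (encW p) = encW (phi p)].

Lemma corr_equiv phi psi phi' psi' : equiv_rep phi psi ->
  equiv_rep phi' psi' -> corr phi phi' -> corr psi psi'.
Proof.
move=> [V [cV V1 V2 E]] [V' [cV' V1' V2' E']] [U [cU U1 U2 F]].
exists (U `&` (V `&` encW @^-1` V')); split.
- by apply/cofiniteI/cofiniteI/encW_preimage_cofinite.
- by move=> p [_ [/V2]].
- by move=> p [_ [_ /V2']].
- by move=> p [Up [Vp Vp']]; rewrite -E // -E' // F.
Qed.

Lemma corr_comp phi psi phi' psi' : corr phi phi' -> corr psi psi' ->
  corr (comp_rep phi psi) (comp_rep phi' psi').
Proof.
move=> [U [cU U1 U2 E]] [V [cV V1 V2 F]].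
exists (V `&` (dom psi `&` psi @^-1` U)); split.
- by apply: cofiniteI => //; apply: preimage_cofinite.
- by move=> p [_ [dp Up]]; split=> //; apply: U1.
- by move=> p [Vp [dp Up]]; split; [apply: V2|rewrite /= F //; apply: U2].
- by move=> p [Vp [dp Up]]; rewrite /= F // E.
Qed.

Lemma corr_uniql phi psi chi :
  corr phi chi -> corr psi chi -> equiv_rep phi psi.
Proof.
move=> [U [cU U1 U2 E]] [V [cV V1 V2 F]]; exists (U `&` V); split.
- exact: cofiniteI.
- by move=> p [/U1].
- by move=> p [_ /V1].
- by move=> p [Up Vp]; apply: encW_inj; rewrite -E // F.
Qed.

(** Paths ending in [None] are outside the image of [encW], but below an encoded path both
    representatives just append the remaining word, so agreement on encoded paths suffices. *)
Lemma corr_uniqr chi phi psi : higman_thompson phi -> higman_thompson psi ->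
  corr chi phi -> corr chi psi -> equiv_rep phi psi.
Proof.
move=> hphi hpsi [U [cU U1 U2 E]] [V [cV V1 V2 F]].
exists [set q | exists2 p, (U `&` V) p & wprefix (encW p) q]; split.
- exact/encW_upset_cofinite/cofiniteI.
- move=> q [p [/U2 dp _]]; exact: (dom_cofinite phi).2.
- move=> q [p [_ /V2 dp]]; exact: (dom_cofinite psi).2.
- move=> q [p [Up Vp] /wprefixP [s Es]]; apply: walk_inj.
  have [_ /(_ _ _ Es) ->] := HT_shifts hphi (U2 _ Up).
  have [_ /(_ _ _ Es) ->] := HT_shifts hpsi (V2 _ Vp).
  by rewrite E // F.
Qed.

Lemma corr_totalr phi : higman_thompson phi ->
  exists phi', higman_thompson phi' /\ corr phi phi'.
Proof.
move=> hphi; have sh := HT_shifts hphi; have [B [fB Bd _ covB] _] := hphi.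
pose spec (q q' : @walk H R) := exists p s,
  [/\ dom phi p, word q = enc p ++ s & word q' = enc (phi p) ++ s].
(* Read forward, the transported map is well defined; read backward, it is injective. Two
   decompositions of one path have comparable [p1] and [p2] by [enc_total], and [phi] carries the
   surplus word along unchanged. *)
have spec_uniq q1 q2 q1' q2' : spec q1 q1' -> spec q2 q2' ->
    (q1 = q2 <-> q1' = q2').
  have phi_ext p1 p2 t : dom phi p1 -> word p2 = word p1 ++ t ->
      word (phi p2) = word (phi p1) ++ t.
    by move=> d1 E; apply: (sh _ d1).2.
  have ext_phi p1 p2 t : dom phi p1 -> dom phi p2 ->
      word (phi p2) = word (phi p1) ++ t -> word p2 = word p1 ++ t.
    move=> d1 d2 E; have /wprefixP [t' E'] : wprefix p1 p2.
      by apply/(fn_prefix d1 d2)/wprefixP; exists t.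
    have := phi_ext _ _ _ d1 E'; rewrite E => /(congr1 (drop (size (phi p1)))).
    by rewrite !drop_size_cat // => ->.
  have catD (T : Type) (a b c : seq T) : a ++ b = a ++ c -> b = c.
    by move=> /(congr1 (drop (size a))); rewrite !drop_size_cat.
  move=> [p1 [s1 [d1 E1 E1']]] [p2 [s2 [d2 E2 E2']]].
  split=> E; subst; apply: walk_inj.
    have := E2; rewrite E1 E1' E2' => E; have [t [Et|Et]] := enc_total E.
      move: E; rewrite (phi_ext _ _ _ d1 Et) Et !enc_cat -!catA.
      by move=> /catD ->.
    move: E; rewrite (phi_ext _ _ _ d2 Et) Et !enc_cat -!catA.
    by move=> /catD ->.
  have := E2'; rewrite E1' E1 E2 => E; have [t [Et|Et]] := enc_total E.
    move: E; rewrite (ext_phi _ _ _ d1 d2 Et) Et !enc_cat -!catA.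
    by move=> /catD ->.
  move: E; rewrite (ext_phi _ _ _ d2 d1 Et) Et !enc_cat -!catA.
  by move=> /catD ->.
pose S := [set q | exists2 p, dom phi p & wprefix (encW p) q].
have spec_ex q : exists q', S q -> spec q q'.
  have [[p dp /wprefixP [s E]]|nS] := pselect (S q); last by exists q.
  have hs : @is_walk H (target (encW (phi p))) s.
    by rewrite target_encW (sh _ dp).1 -target_encW; exact: walk_split E.
  by have [q' E'] := walk_extend hs; exists q' => _; exists p, s.
have [f fP] := choice spec_ex.
have SencW p : dom phi p -> S (encW p).
  by move=> dp; exists p => //; apply: wprefix_refl.
have f_eq q q' : S q -> spec q q' -> f q = q'.
  by move=> Sq h; apply/(spec_uniq _ _ _ _ (fP _ Sq) h).
have f_encW p : dom phi p -> f (encW p) = encW (phi p).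
  by move=> dp; apply: f_eq; [apply: SencW|exists p, [::]; rewrite !cats0].
have cS := encW_upset_cofinite (dom_cofinite phi).
have [|||||||phi' [hphi' dphi' Ephi']] :=
    @HT_of_shift_map H R S (encW @` B) f cS.
- exact: finite_image.
- by move=> _ [b /Bd db <-]; apply: SencW.
- move=> q [p dp pq]; have [b Bb bp] := covB _ dp.
  by exists (encW b); [exists b|apply: wprefix_trans pq; apply/encW_prefix].
- move=> q Sq; have [p [s [dp E E']]] := fP _ Sq.
  rewrite (@target_cat _ _ (encW p) q s) // target_encW.
  by rewrite (@target_cat _ _ (encW (phi p)) _ s) // target_encW (sh _ dp).1.
- move=> q d t Sq Ed; have [p [s [dp E E']]] := fP _ Sq.
  have [x Ex] : exists x : @walk H R, word x = word (f q) ++ t.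
    apply: walk_extend; rewrite (@target_cat _ _ (encW (phi p)) _ s) //.
    rewrite target_encW (sh _ dp).1 -target_encW -(@target_cat _ _ _ q s) //.
    exact: walk_split Ed.
  rewrite -Ex; congr word.
  apply: f_eq; first exact: (cofinite_up cS Sq Ed).
  by exists p, (s ++ t); rewrite Ed Ex E E' !catA.
- by move=> p q Sp Sq E; apply/(spec_uniq _ _ _ _ (fP _ Sp) (fP _ Sq)).
(* The image contains every extension of an encoded path of [cod phi]: the leftover word can be
   appended to the encoded preimage, as targets agree. *)
- have [fin _] := encW_upset_cofinite (cod_cofinite phi).
  apply: sub_finite_set fin => q nq [p' /fn_surj [p dp <-] /wprefixP [s E]].
  apply: nq; have hs : @is_walk H (target (encW p)) s.
    by rewrite target_encW -(sh _ dp).1 -target_encW; exact: walk_split E.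
  have [d Ed] := walk_extend hs.
  have Sd : S d by apply: cofinite_up Ed; [|apply: SencW].
  by exists d => //; apply: f_eq => //; exists p, s.
exists phi'; split=> //; exists (dom phi); split=> //.
- exact: dom_cofinite.
- by move=> p dp; rewrite dphi'; apply: SencW.
- by move=> p dp; rewrite Ephi'; apply: f_encW.
Qed.

Lemma corr_totall phi' : locally_finite G -> higman_thompson phi' ->
  exists phi, higman_thompson phi /\ corr phi phi'.
Proof.
move=> lf hphi; have sh := HT_shifts hphi; have [B [fB Bd indB covB] _] := hphi.
(* Strictly below the basis, [phi'] preserves the last edge of a path, hence
   maps the image of [encW] to itself in both directions. *)
pose D := dom phi' `\` B.
have encW_iff q : D q ->
    (exists p, q = encW p) <-> (exists p, phi' q = encW p).
  move=> [dq nBq]; have [b Bb /wprefixP [s E]] := covB _ dq.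
  have E' := (sh _ (Bd _ Bb)).2 _ _ E.
  case/lastP: s E E' => [|s e] E E'.
    by case: nBq; rewrite (_ : q = b) //; apply: walk_inj; rewrite E cats0.
  (* Both [q] and [phi' q] end in the edge [e], so either both or neither end in [None]. *)
  have [p Ep] := encW_cases q; have [p' Ep'] := encW_cases (phi' q).
  rewrite -!rcons_cat in E E'.
  split=> -[x Ex].
    exists p'; apply: walk_inj; case: Ep' => // -[_].
    rewrite E' => /rcons_inj [_ En].
    by move: E; rewrite Ex /= En => /enc_no_hook.
  exists p; apply: walk_inj; case: Ep => // -[_].
  rewrite E => /rcons_inj [_ En].
  by move: E'; rewrite Ex /= En => /enc_no_hook.
have cD : cofinite_subspace D.
  split.
    apply: (@sub_finite_set _ _ (~` dom phi' `|` B)).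
      move=> q nDq; have [dq|] := pselect (dom phi' q); last by left.
      by right; apply: contrapT => nBq; apply: nDq.
    by rewrite finite_setU; split=> //; case: (dom_cofinite phi').
  move=> q q' [dq nBq] qq'; split; first exact: (dom_cofinite phi').2 qq'.
  (* By independence, an extension of [q] in [B] equals the basis element that is a prefix of [q],
     which squeezes [q] itself into [B]. *)
  move=> Bq'; have [b Bb bq] := covB _ dq.
  have bq' : b = q' by apply: indB => //; apply: wprefix_trans qq'.
  apply: nBq; rewrite (_ : q = b) //; apply: wprefix_anti => //.
  by rewrite bq'.
have cU := encW_preimage_cofinite cD; set U := _ @^-1` _ in cU.
have f_ex p : exists p', U p -> phi' (encW p) = encW p'.
  have [Up|nUp] := pselect (U p); last by exists p.
  have [|p' E] := (encW_iff _ Up).1; first by exists p.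
  by exists p'.
have [f fP] := choice f_ex.
(* [B] was removed from the domain, so it gives no cover inside [U]; local finiteness supplies
   one. *)
have [C [fC CU covC]] := finite_cover lf cU.
have [||||phi [hphi' dphi Ephi]] := HT_of_shift_map (f := f) cU fC CU covC.
- move=> p Up; rewrite -!target_encW -fP //.
  by apply: (sh _ _).1; case: Up.
- move=> p d s Up E.
  have Ud : U d by apply: cofinite_up Up E.
  apply: enc_inj; rewrite enc_cat.
  have := (sh _ Up.1).2 (enc s) (encW d).
  by rewrite !fP //= => -> //; rewrite E enc_cat.
- move=> p q Up Uq E; apply: encW_inj; apply: (fn_inj Up.1 Uq.1).
  by rewrite !fP // E.
(* For all but finitely many [p], [encW p] is [phi' q] with [q] in [D]; by the converse half of
   [encW_iff], [q] is itself encoded, so [p] is a value of [f]. *)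
- have := encW_preimage_cofinite (image_cofinite (phi := phi') (U := D) _ cD).
  case=> [|fin _]; first by move=> q [].
  apply: sub_finite_set fin => p np [q Dq E]; apply: np.
  have [|p0 E0] := (encW_iff _ Dq).2; first by exists p.
  by subst q; exists p0 => //; apply: encW_inj; rewrite -fP.
exists phi; split=> //; exists U; split=> //.
- by rewrite dphi.
- by move=> p [].
- by move=> p Up; rewrite Ephi fP.
Qed.

End Hook.

(** * The isomorphism of groups *)

Lemma bij_of_corr (A B : Type) (r : A -> B -> Prop) :
  (forall a, exists b, r a b) -> (forall b, exists a, r a b) ->
  (forall a a' b, r a b -> r a' b -> a = a') ->
  (forall a b b', r a b -> r a b' -> b = b') ->
  exists2 f : A -> B, (forall a, r a (f a)) & bijective f.
Proof.
move=> /choice [f fP] /choice [g gP] il ir; exists f => //.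
by exists g => [a|b]; [apply: il (gP _) _|apply: ir (fP _) _].
Qed.

Theorem corollary1 (G : digraph) (R : vertex G) (v w : vertex G)
    (theta : out_edge w -> out_edge v) :
  locally_finite G -> rooted G R -> v <> w ->
  injective theta ->
  (forall e : out_edge w, terminus (sval (theta e)) = terminus (sval e)) ->
  isomorphic_groups (HT G R) (HT (hook theta) R).
Proof.
move=> lf _ vw theta_inj theta_term.
(* One corresponding pair of Higman-Thompson representatives is enough: [corr_equiv] allows a change
   of representatives in the uniqueness arguments. *)
pose r (x : HT G R) (y : HT (hook theta) R) := exists phi psi,
  [/\ aclass phi = val x, aclass psi = val y, higman_thompson phi,
      higman_thompson psi & corr vw theta_inj theta_term phi psi].

have HT_rep (K : digraph) (S : vertex K) (x : HT K S) :
    exists2 phi, aclass phi = val x & higman_thompson phi.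
  by have /asboolP := valP x.
have HT_of (K : digraph) (S : vertex K) (phi : almost_aut S) :
    higman_thompson phi -> exists x : HT K S, val x = aclass phi.
  move=> h; have hx : HT_class (aclass phi) by apply/asboolP; exists phi.
  by exists (Sub (aclass phi) hx); rewrite SubK.
have r_injl x x' y : r x y -> r x' y -> x = x'.
  move=> [phi [psi [Ex Ey _ _ c]]] [phi' [psi' [Ex' Ey' _ _ c']]].
  apply: val_inj; rewrite -Ex -Ex'; apply/aclassP; apply: corr_uniql c _.
  apply: corr_equiv c'; first exact: equiv_rep_refl.
  by apply/aclassP; rewrite Ey Ey'.
have r_injr x y y' : r x y -> r x y' -> y = y'.
  move=> [phi [psi [Ex Ey _ h c]]] [phi' [psi' [Ex' Ey' _ h' c']]].
  apply: val_inj; rewrite -Ey -Ey'; apply/aclassP; apply: corr_uniqr h h' c _.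
  apply: corr_equiv c'; last exact: equiv_rep_refl.
  by apply/aclassP; rewrite Ex Ex'.
have [||//|//|f fP f_bij] := @bij_of_corr _ _ r.
- move=> x; have [phi Ex h] := HT_rep _ _ x.
  have [psi [h' c]] := corr_totalr vw theta_inj theta_term h.
  by have [y Ey] := HT_of _ _ _ h'; exists y, phi, psi.
- move=> y; have [psi Ey h] := HT_rep _ _ y.
  have [phi [h' c]] := corr_totall vw theta_inj theta_term lf h.
  by have [x Ex] := HT_of _ _ _ h'; exists x, phi, psi.
(* Composites of corresponding representatives correspond, so [f x * f y] is related to [x * y], and
   uniqueness identifies it with [f (x * y)]. *)
have fM : {morph f : x y / (x * y)%g}.
  move=> x y; apply: r_injr (fP _) _.
  have [phi [psi [Ex Ey h k c]]] := fP x.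
  have [phi' [psi' [Ex' Ey' h' k' c']]] := fP y.
  exists (comp_rep phi phi'), (comp_rep psi psi'); split.
  - by rewrite -amulE Ex Ex'.
  - by rewrite -amulE Ey Ey'.
  - exact: HT_comp.
  - exact: HT_comp.
  - exact: corr_comp.
pose fm : {multiplicative HT G R -> HT (hook theta) R} :=
  HB.pack f (isMultiplicative.Build _ _ f fM).
by exists fm.
Qed.
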